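(* Let $\mathbb{F}$ be an algebraically closed field of characteristic $3$. Every non-trivial $2$-dimensional left unital algebra over $\mathbb{F}$ is isomorphic to exactly one of the following pairwise non-isomorphic left unital algebras, given by their matrices of structure constants (MSC): \begin{itemize} \item $A_{1,3}\left(\alpha_1,\frac{\alpha_1(1-\alpha_1)}{\beta_1}-\frac{1}{2},\frac{\alpha_1(1-\alpha_1)^2}{\beta^2_1}-\frac{1-\alpha_1}{2\beta_1},\beta_1\right)=\left(\begin{array}{cccc}\alpha_1 & \frac{2\alpha_1-2\alpha_1^2-\beta_1}{2\beta_1} & \frac{2\alpha_1-2\alpha_1^2+\beta_1}{2\beta_1} & \frac{2\alpha_1-4\alpha_1^2+2\alpha_1^3-\beta_1+\alpha_1\beta_1}{2\beta_1^2}\\ \beta_1 & -\alpha_1 & 1-\alpha_1 & \frac{-2\alpha_1+2\alpha_1^2+\beta_1}{2\beta_1}\end{array}\right)$, where $\alpha_1,\beta_1\in\mathbb{F}$, $\beta_1\neq 0$; \item $A_{1,3}\left(1,\alpha_2,\frac{\alpha_2(2\alpha_2+1)}{2},0\right)=\left(\begin{array}{cccc}1 & \alpha_2 & 1+\alpha_2 & \frac{1}{2}(\alpha_2+2\alpha_2^2)\\ 0 & -1 & 0 & -\alpha_2\end{array}\right)$, where $\alpha_2\in\mathbb{F}$; \item $A_{2,3}(\alpha_1,0,\alpha_1)=\left(\begin{array}{cccc}\alpha_1 & 0 & 0 & 1\\ 0 & \alpha_1 & -\alpha_1+1 & 0\end{array}\right)$, where $\alpha_1\in\mathbb{F}$,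 $\alpha_1\neq 0$; \item $A_{4,3}(\alpha_1,\alpha_1)=\left(\begin{array}{cccc}\alpha_1 & 0 & 0 & 0\\ 0 & \alpha_1 & -\alpha_1+1 & 0\end{array}\right)$, where $\alpha_1\in\mathbb{F}$, $\alpha_1\neq 0$; \item $A_{6,3}\left(\frac{1}{2},0\right)=\left(\begin{array}{cccc}\frac{1}{2} & 0 & 0 & 1\\ 0 & \frac{1}{2} & -\frac{1}{2} & 0\end{array}\right)$; \item $A_{8,3}\left(\frac{1}{2}\right)=\left(\begin{array}{cccc}\frac{1}{2} & 0 & 0 & 0\\ 0 & \frac{1}{2} & -\frac{1}{2} & 0\end{array}\right)$. \end{itemize} (Different families, and different parameter values within a family, give non-isomorphic algebras.)
   Context: An algebra over a field $\mathbb{F}$ is a vector space $\mathbb{A}$ with a bilinear multiplication (not assumed associative, commutative or unital). It is non-trivial if its multiplication is not identically zero. For a $2$-dimensional algebra with basis $(e_1,e_2)$, its matrix of structure constants (MSC) is the $2\times 4$ matrix $A=\left(\begin{array}{cccc}\alpha_1&\alpha_2&\alpha_3&\alpha_4\\ \beta_1&\beta_2&\beta_3&\beta_4\end{array}\right)$ over $\mathbb{F}$ with $e_1e_1=\alpha_1e_1+\beta_1e_2$, $e_1e_2=\alpha_2e_1+\beta_2e_2$, $e_2e_1=\alpha_3e_1+\beta_3e_2$, $e_2e_2=\alpha_4e_1+\beta_4e_2$; equivalently, in coordinate columns, the product of $u$ and $v$ is $A(u\otimes v)$ with $\otimes$ the Kronecker product. An algebra is identified with its MSC. Two algebras with MSCs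 $A$ and $B$ are isomorphic iff $B=gA(g^{-1})^{\otimes 2}$ for some $g\in GL(2;\mathbb{F})$. An algebra $\mathbb{A}$ is left unital if there is an element $\mathbf{1}_L\in\mathbb{A}$ with $\mathbf{1}_L\cdot\mathbf{u}=\mathbf{u}$ for all $\mathbf{u}\in\mathbb{A}$. The symbols $A_{i,3}(\cdot)$ are just names; the algebras meant are those given by the explicit matrices. *)

(* Defs.v *)
From HB Require Import structures.
From mathcomp Require Import all_boot all_order all_algebra.
From mathcomp Require Import mxtens.

Set Implicit Arguments.
Unset Strict Implicit.
Unset Printing Implicit Defensive.

Import GRing.Theory.
Local Open Scope ring_scope.

(* An algebra on V is given by its multiplication, {bilinear V -> V -> V}. *)

Definition nontrivial_alg (F : fieldType) (V : lmodType F)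
    (mu : {bilinear V -> V -> V}) : Prop :=
  exists u v : V, mu u v != 0.

Definition left_unital (F : fieldType) (V : lmodType F)
    (mu : {bilinear V -> V -> V}) : Prop :=
  exists e : V, left_id e mu.

Definition alg_iso (F : fieldType) (U V : lmodType F)
    (mu : {bilinear U -> U -> U}) (nu : {bilinear V -> V -> V}) : Prop :=
  exists f : {linear U -> V},
    bijective f /\ (forall x y : U, f (mu x y) = nu (f x) (f y)).

(* Columns of A are ordered e1e1, e1e2, e2e1, e2e2, which is the row-major
   order used by tensmx. *)
Definition msc_mul (F : fieldType) (A : 'M[F]_(2, 4)) (u v : 'cV[F]_2) :
  'cV[F]_2 := A *m (u *t v).

Lemma msc_mul_is_bilinear (F : fieldType) (A : 'M[F]_(2, 4)) :
  bilinear_for *:%R *:%R (msc_mul A).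
Proof.
split=> [v|u] a x y.
  change (msc_mul A (a *: x + y) v = a *: msc_mul A x v + msc_mul A y v).
  rewrite /msc_mul scalemxAr -[RHS]mulmxDr; congr (_ *m _).
  by apply/matrixP=> i j; rewrite !mxE mulrDl mulrA.
change (msc_mul A u (a *: x + y) = a *: msc_mul A u x + msc_mul A u y).
rewrite /msc_mul scalemxAr -[RHS]mulmxDr; congr (_ *m _).
by apply/matrixP=> i j; rewrite !mxE mulrDr mulrCA.
Qed.

HB.instance Definition _ (F : fieldType) (A : 'M[F]_(2, 4)) :=
  bilinear_isBilinear.Build F 'cV[F]_2 'cV[F]_2 'cV[F]_2 *:%R *:%R
    (msc_mul A) (msc_mul_is_bilinear A).

Definition msc_alg (F : fieldType) (A : 'M[F]_(2, 4)) :
  {bilinear 'cV[F]_2 -> 'cV[F]_2 -> 'cV[F]_2} := msc_mul A.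

Lemma delta_tensmx (F : fieldType) (i j : 'I_2) :
  delta_mx i 0 *t delta_mx j 0 = delta_mx (mxtens_index (i, j)) 0
  :> 'M[F]_(2 * 2, 1 * 1).
Proof.
apply/matrixP=> k l; case: (mxtens_indexP k) => k1 k2.
case: (mxtens_indexP l) => l1 l2; rewrite tensmxE [RHS]mxE.
rewrite ![delta_mx _ _ _ _]mxE !ord1 !eqxx !andbT.
by rewrite -natrM mulnb (can_eq (@mxtens_indexK 2 2)) xpair_eqE.
Qed.

Lemma msc_alg_delta (F : fieldType) (A : 'M[F]_(2, 4)) (i j : 'I_2) :
  msc_alg A (delta_mx i 0) (delta_mx j 0) = col (mxtens_index (i, j)) A.
Proof. by rewrite colE; congr (_ *m _); apply: delta_tensmx. Qed.

Lemma msc_isoP (F : fieldType) (A B : 'M[F]_(2, 4)) :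
  alg_iso (msc_alg A) (msc_alg B) <->
  exists2 g : 'M[F]_2, g \in unitmx & B = g *m A *m (invmx g *t invmx g).
Proof.
split=> [[f [[h _ hK] fM]]|[g g_unit ->]]; last first.
  exists (mulmx g : {linear 'cV[F]_2 -> 'cV[F]_2}); split.
    by exists (mulmx (invmx g)); [exact: mulKmx | exact: mulKVmx].
  move=> x y; rewrite /msc_alg /= /msc_mul -!mulmxA; congr (_ *m (_ *m _)).
  have E := tensmx_mul (invmx g) (invmx g) (g *m x) (g *m y).
  by rewrite !mulKmx // in E; exact: esym E.
pose g := \matrix_(i, j) f (delta_mx j 0) i 0.
have fE x : f x = g *m x.
  rewrite {1}[x]matrix_sum_delta linear_sum; apply/colP=> i.
  rewrite summxE !mxE; apply: eq_bigr => j _.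
  by rewrite big_ord1 linearZ !mxE mulrC.
have g_unit : g \in unitmx.
  apply: (proj1 (mulmx1_unit (B := \matrix_(i, j) h (delta_mx j 0) i 0) _)).
  apply/matrixP=> i j.
  have := congr1 (fun u : 'cV_2 => u i 0) (hK (delta_mx j 0)).
  rewrite fE !mxE andbT => <-; apply: eq_bigr => k _; congr (_ * _).
  by rewrite !mxE.
exists g => //.
have gAE : B *m (g *t g) = g *m A.
  apply/matrixP=> r k; case: (@mxtens_indexP 2 2 k) => i j.
  have := congr1 (fun u : 'cV_2 => u r 0) (fM (delta_mx i 0) (delta_mx j 0)).
  rewrite !fE /msc_alg /= /msc_mul -tensmx_mul delta_tensmx !mulmxA.
  by rewrite -!colE !mxE => ->.
have ggV : (g *t g) *m (invmx g *t invmx g) = 1%:M :> 'M[F]_(2 * 2).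
  rewrite tensmx_mul mulmxV //; apply/matrixP=> k l.
  case: (mxtens_indexP k) => k1 k2; case: (mxtens_indexP l) => l1 l2.
  rewrite tensmxE !mxE -natrM mulnb.
  by rewrite (can_eq (@mxtens_indexK 2 2)) xpair_eqE.
have E := mulmxA (B : 'M_(2, 2 * 2)) (g *t g) (invmx g *t invmx g).
by rewrite -gAE; apply: etrans E; rewrite ggV mulmx1.
Qed.

(* The algebras of the list; tags carry the index i of A_{i,3}, A1 and A1'
   being the subfamilies with beta1 <> 0 and with beta1 = 0. *)
Inductive lu_param (F : Type) :=
  | LU_A1 of F & F
  | LU_A1' of F
  | LU_A2 of F
  | LU_A4 of F
  | LU_A6
  | LU_A8.

Arguments LU_A6 {F}.
Arguments LU_A8 {F}.

Definition lu_admissible (F : fieldType) (p : lu_param F) : Prop :=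
  match p with
  | LU_A1 _ b1 => b1 != 0
  | LU_A2 a1 | LU_A4 a1 => a1 != 0
  | _ => True
  end.

Definition mx24 (F : fieldType) (r1 r2 : seq F) : 'M[F]_(2, 4) :=
  \matrix_(i, j) (if i == 0 then r1`_j else r2`_j).

Definition lu_msc (F : fieldType) (p : lu_param F) : 'M[F]_(2, 4) :=
  match p with
  | LU_A1 a1 b1 => mx24
      [:: a1;
          (2 * a1 - 2 * a1 ^+ 2 - b1) / (2 * b1);
          (2 * a1 - 2 * a1 ^+ 2 + b1) / (2 * b1);
          (2 * a1 - 4 * a1 ^+ 2 + 2 * a1 ^+ 3 - b1 + a1 * b1)
            / (2 * b1 ^+ 2)]
      [:: b1; - a1; 1 - a1; (- 2 * a1 + 2 * a1 ^+ 2 + b1) / (2 * b1)]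
  | LU_A1' a2 => mx24
      [:: 1; a2; 1 + a2; 2^-1 * (a2 + 2 * a2 ^+ 2)]
      [:: 0; -1; 0; - a2]
  | LU_A2 a1 => mx24
      [:: a1; 0; 0; 1]
      [:: 0; a1; - a1 + 1; 0]
  | LU_A4 a1 => mx24
      [:: a1; 0; 0; 0]
      [:: 0; a1; - a1 + 1; 0]
  | LU_A6 => mx24
      [:: 2^-1; 0; 0; 1]
      [:: 0; 2^-1; - 2^-1; 0]
  | LU_A8 => mx24
      [:: 2^-1; 0; 0; 0]
      [:: 0; 2^-1; - 2^-1; 0]
  end.

(* Main.v *)
(** The traces of left and right multiplication are two linear forms attached
    canonically to an algebra. If they are independent, their dual basis is
    canonical too; in it, left unitality leaves exactly the matrices A1 and A1'.
    Otherwise complete a left unit e to a basis (e, f), where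
    f e = x e + c f and f f = p e + q f. Dependence reads
    2 q = (1 + c) (x + q), which is exactly what allows a shift f + t e to kill
    both x and q; rescaling f then turns p into 0 or 1, and the families A2, A4
    (c <> -1) and A6, A8 (c = -1) remain. *)

From HB Require Import structures.
Require Import Defs.
From mathcomp Require Import all_boot all_order all_algebra.
From mathcomp Require Import mxtens ring.

Set Implicit Arguments.
Unset Strict Implicit.
Unset Printing Implicit Defensive.

Import GRing.Theory.
Local Open Scope ring_scope.

Lemma ord2P (P : 'I_2 -> Prop) : P 0 -> P 1 -> forall i, P i.
Proof.
move=> P0 P1 [[|[|i]] lt_i2] //.
  by rewrite (_ : Ordinal _ = 0) //; apply: val_inj.
by rewrite (_ : Ordinal _ = 1) //; apply: val_inj.
Qed.

(** * Transport along isomorphisms of algebras *)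

Lemma alg_iso_sym (F : fieldType) (U V : lmodType F)
    (mu : {bilinear U -> U -> U}) (nu : {bilinear V -> V -> V}) :
  alg_iso mu nu -> alg_iso nu mu.
Proof.
move=> [f [[h fK hK] fM]].
have h_linear : linear h by exact: can2_linear fK hK.
pose hM := GRing.isLinear.Build F V U _ h h_linear.
pose hL : {linear V -> U} := HB.pack h hM.
exists hL; split; first by exists f.
by move=> x y /=; rewrite -{1}(hK x) -{1}(hK y) -fM fK.
Qed.

Lemma alg_iso_trans (F : fieldType) (U V W : lmodType F)
    (mu : {bilinear U -> U -> U}) (nu : {bilinear V -> V -> V})
    (xi : {bilinear W -> W -> W}) :
  alg_iso mu nu -> alg_iso nu xi -> alg_iso mu xi.
Proof.
move=> [f [f_bij fM]] [h [h_bij hM]].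
exists (h \o f : {linear U -> W}); split; first exact: bij_comp.
by move=> x y /=; rewrite fM hM.
Qed.

Lemma left_unital_iso (F : fieldType) (U V : lmodType F)
    (mu : {bilinear U -> U -> U}) (nu : {bilinear V -> V -> V}) :
  alg_iso mu nu -> left_unital mu -> left_unital nu.
Proof.
move=> [f [[h _ hK] fM]] [e eP]; exists (f e) => x.
by rewrite -(hK x) -fM eP.
Qed.

Lemma left_unital_nontrivial (F : fieldType) (V : lmodType F)
    (mu : {bilinear V -> V -> V}) (u : V) :
  u != 0 -> left_unital mu -> nontrivial_alg mu.
Proof. by move=> u_neq0 [e eP]; exists e, u; rewrite eP. Qed.

(** * Coordinates and trace forms in dimension two *)

Section TwoDim.
Variable F : fieldType.
Implicit Types (A B : 'M[F]_(2, 4)) (u v x y : 'cV[F]_2).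

Lemma cV2P u v : u 0 0 = v 0 0 -> u 1 0 = v 1 0 -> u = v.
Proof. by move=> E0 E1; apply/colP; apply: ord2P. Qed.

Definition vec2 (a b : F) : 'cV[F]_2 := \col_i (if i == 0 then a else b).

Lemma vec2_0 a b : vec2 a b 0 0 = a. Proof. by rewrite mxE. Qed.
Lemma vec2_1 a b : vec2 a b 1 0 = b. Proof. by rewrite mxE. Qed.
Definition vec2E := (vec2_0, vec2_1).

Lemma msc_algE A u v i :
  msc_alg A u v i 0 =
    A i 0 * (u 0 0 * v 0 0) + A i 1 * (u 0 0 * v 1 0)
    + A i 2 * (u 1 0 * v 0 0) + A i 3 * (u 1 0 * v 1 0).
Proof.
rewrite /msc_alg /= /msc_mul mxE !big_ord_recl big_ord0 addr0 !addrA.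
congr (_ + _ + _ + _); (congr (_ * _); last rewrite mxE).
- congr (u _ _ * v _ _); exact: val_inj.
- by congr (A _ _); apply: val_inj.
- congr (u _ _ * v _ _); exact: val_inj.
- by congr (A _ _); apply: val_inj.
- congr (u _ _ * v _ _); exact: val_inj.
- by congr (A _ _); apply: val_inj.
- congr (u _ _ * v _ _); exact: val_inj.
Qed.

Lemma msc_alg_inj A B : msc_alg A =2 msc_alg B -> A = B.
Proof.
move=> eqAB; apply/matrixP=> r k; case: (@mxtens_indexP 2 2 k) => i j.
have := congr1 (fun u : 'cV_2 => u r 0) (eqAB (delta_mx i 0) (delta_mx j 0)).
by rewrite !msc_alg_delta !mxE.
Qed.

Definition endo_trace (phi : 'cV[F]_2 -> 'cV[F]_2) : F :=
  phi (delta_mx 0 0) 0 0 + phi (delta_mx 1 0) 1 0.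

(** Both maps are multiplication by a matrix, and [g] conjugates one matrix into the other, so
    cyclicity of the matrix trace applies. *)
Lemma endo_trace_conj (phi psi : {linear 'cV[F]_2 -> 'cV[F]_2}) (g : 'M[F]_2) :
  g \in unitmx -> (forall x, g *m phi x = psi (g *m x)) ->
  endo_trace phi = endo_trace psi.
Proof.
move=> g_unit gP.
pose mx (chi : 'cV[F]_2 -> 'cV[F]_2) := \matrix_(i, j) chi (delta_mx j 0) i 0.
have mxK (chi : {linear 'cV[F]_2 -> 'cV[F]_2}) x : mx chi *m x = chi x.
  rewrite {2}[x]matrix_sum_delta linear_sum; apply/colP=> i.
  rewrite summxE !mxE; apply: eq_bigr => j _.
  by rewrite big_ord1 linearZ !mxE mulrC.
have trE chi : endo_trace chi = \tr (mx chi).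
  rewrite /mxtrace big_ord_recl big_ord1 !mxE.
  by rewrite (_ : lift _ _ = 1) //; apply: val_inj.
have gmx : g *m mx phi = mx psi *m g.
  apply/matrixP=> i j.
  have := congr1 (fun u : 'cV_2 => u i 0) (gP (delta_mx j 0)).
  by rewrite -(mxK phi) -(mxK psi) !mulmxA -!colE [LHS]mxE [RHS]mxE.
by rewrite !trE -[mx phi](mulKmx g_unit) gmx mxtrace_mulC mulmxK.
Qed.

(** The trace of left multiplication by [x], expanded as a linear form in [x]; [rtrace] is its
    analogue for right multiplication. *)
Definition ltrace A x : F := (A 0 0 + A 1 1) * x 0 0 + (A 0 2 + A 1 3) * x 1 0.
Definition rtrace A x : F := (A 0 0 + A 1 2) * x 0 0 + (A 0 1 + A 1 3) * x 1 0.

Lemma ltraceE A x : ltrace A x = endo_trace (msc_alg A x).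
Proof. by rewrite /endo_trace !msc_algE !mxE /= /ltrace; ring. Qed.

Lemma rtraceE A x : rtrace A x = endo_trace ((msc_alg A)^~ x).
Proof. by rewrite /endo_trace !msc_algE !mxE /= /rtrace; ring. Qed.

(** A multiplicative [g] intertwines left multiplication by [x] with left multiplication by
    [g *m x], and likewise on the right, so conjugation invariance of the trace applies. *)
Lemma trace_mulmx A B (g : 'M[F]_2) :
  g \in unitmx ->
  (forall x y, g *m msc_alg A x y = msc_alg B (g *m x) (g *m y)) ->
  (forall x, ltrace B (g *m x) = ltrace A x)
  /\ (forall x, rtrace B (g *m x) = rtrace A x).
Proof.
move=> g_unit gM; split=> x; apply/esym.
  rewrite !ltraceE; apply: (@endo_trace_conj (msc_alg A x)
    (msc_alg B (g *m x)) _ g_unit) => y; exact: gM.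
rewrite !rtraceE; apply: (@endo_trace_conj (applyr (msc_alg A) x)
  (applyr (msc_alg B) (g *m x)) _ g_unit) => y; exact: gM.
Qed.

Lemma msc_conjM A B (g : 'M[F]_2) :
  g \in unitmx -> B = g *m A *m (invmx g *t invmx g) ->
  forall x y, g *m msc_alg A x y = msc_alg B (g *m x) (g *m y).
Proof.
move=> g_unit -> x y.
rewrite /msc_alg /= /msc_mul -!mulmxA; congr (_ *m (_ *m _)).
have E := tensmx_mul (invmx g) (invmx g) (g *m x) (g *m y).
by rewrite !mulKmx // in E; exact: esym E.
Qed.

Lemma trace_iso A B : alg_iso (msc_alg A) (msc_alg B) ->
  exists2 g : 'M[F]_2, g \in unitmx &
    [/\ forall x y, g *m msc_alg A x y = msc_alg B (g *m x) (g *m y),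
        forall x, ltrace B (g *m x) = ltrace A x
      & forall x, rtrace B (g *m x) = rtrace A x].
Proof.
move=> /msc_isoP[g g_unit /(msc_conjM g_unit) gM].
by have [lg rg] := trace_mulmx g_unit gM; exists g.
Qed.

Definition mx22 (a b c d : F) : 'M[F]_2 :=
  \matrix_(i, j) (if i == 0 then vec2 a b j 0 else vec2 c d j 0).

Lemma mx22_mul a b c d x :
  mx22 a b c d *m x
    = vec2 (a * x 0 0 + b * x 1 0) (c * x 0 0 + d * x 1 0).
Proof.
apply: cV2P; rewrite !vec2E mxE big_ord_recl big_ord1 !mxE /=;
  by rewrite (_ : lift ord0 ord0 = 1) //; apply: val_inj.
Qed.

Lemma mx22_unit a b c d : a * d - b * c != 0 -> mx22 a b c d \in unitmx.
Proof.
move=> D_neq0; set D := a * d - b * c.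
apply: (proj1 (mulmx1_unit (B := mx22 (d / D) (- b / D) (- c / D) (a / D)) _)).
have lift1 : lift ord0 ord0 = 1 :> 'I_2 by exact: val_inj.
apply/matrixP; apply: ord2P; apply: ord2P;
  by rewrite [LHS]mxE big_ord_recl big_ord1 !mxE ?lift1 /= /D; field.
Qed.

Lemma mx22_iso A B a b c d : a * d - b * c != 0 ->
  (forall x y, mx22 a b c d *m msc_alg A x y
    = msc_alg B (mx22 a b c d *m x) (mx22 a b c d *m y)) ->
  alg_iso (msc_alg A) (msc_alg B).
Proof.
move=> /mx22_unit g_unit gM.
exists (mulmx (mx22 a b c d) : {linear 'cV[F]_2 -> 'cV[F]_2}); split=> //.
exists (mulmx (invmx (mx22 a b c d))); [exact: mulKmx | exact: mulKVmx].
Qed.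

End TwoDim.

(** * The listed matrices and their left units *)

Lemma mx24E (F : fieldType) (a b c d a' b' c' d' : F) :
  let A := mx24 [:: a; b; c; d] [:: a'; b'; c'; d'] in
  ((A 0 0 = a) * (A 0 1 = b) * (A 0 2 = c) * (A 0 3 = d))
  * ((A 1 0 = a') * (A 1 1 = b') * (A 1 2 = c') * (A 1 3 = d')).
Proof. by do !split; rewrite mxE. Qed.

Lemma mx24_eta (F : fieldType) (A : 'M[F]_(2, 4)) :
  A = mx24 [:: A 0 0; A 0 1; A 0 2; A 0 3] [:: A 1 0; A 1 1; A 1 2; A 1 3].
Proof.
by apply/matrixP; apply: ord2P => -[[|[|[|[|j]]]] lt_j4] //;
   rewrite mxE; congr (A _ _); apply: val_inj.
Qed.

Section Classification.
Variable F : fieldType.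
Hypothesis two_neq0 : 2 != 0 :> F.
Implicit Types (A B : 'M[F]_(2, 4)) (u v x y : 'cV[F]_2).

Lemma msc_left_unitalP A a b :
  A 0 0 * a + A 0 2 * b = 1 -> A 1 0 * a + A 1 2 * b = 0 ->
  A 0 1 * a + A 0 3 * b = 0 -> A 1 1 * a + A 1 3 * b = 1 ->
  left_id (vec2 a b) (msc_alg A).
Proof.
move=> e00 e10 e01 e11 x; apply: cV2P; rewrite msc_algE !vec2E.
  transitivity ((A 0 0 * a + A 0 2 * b) * x 0 0
                + (A 0 1 * a + A 0 3 * b) * x 1 0); first by ring.
  by rewrite e00 e01; ring.
transitivity ((A 1 0 * a + A 1 2 * b) * x 0 0
              + (A 1 1 * a + A 1 3 * b) * x 1 0); first by ring.
by rewrite e10 e11; ring.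
Qed.

Lemma lu_msc_left_unital (p : lu_param F) :
  lu_admissible p -> left_unital (msc_alg (lu_msc p)).
Proof.
have unital A a b := ex_intro (fun e => left_id e (msc_alg A)) (vec2 a b).
case: p => [a1 b1 b1_neq0|a2 _|a1 a1_neq0|a1 a1_neq0|_|_].
(* In A1 and A1' the left trace is the second coordinate, so a left unit has second coordinate [2],
   the trace of the identity; the first coordinate then solves one linear equation. *)
- apply: (unital _ (- 2 * (1 - a1) / b1) 2).
  by apply: msc_left_unitalP; rewrite /= !mx24E; field;
     rewrite ?two_neq0 ?b1_neq0 ?b_neq0.
- apply: (unital _ (- 1 - 2 * a2) 2).
  by apply: msc_left_unitalP; rewrite /= !mx24E; field;
     rewrite ?two_neq0 ?a1_neq0.
(* From here on, left multiplication by the first basis vector is a scalar, and its inverse scales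
   that vector to a left unit. *)
- apply: (unital _ a1^-1 0).
  by apply: msc_left_unitalP; rewrite /= !mx24E; field;
     rewrite ?two_neq0 ?a1_neq0.
- apply: (unital _ a1^-1 0).
  by apply: msc_left_unitalP; rewrite /= !mx24E; field;
     rewrite ?two_neq0 ?a1_neq0.
- apply: (unital _ 2 0).
  by apply: msc_left_unitalP; rewrite /= !mx24E; field;
     rewrite ?two_neq0 ?a1_neq0.
- apply: (unital _ 2 0).
  by apply: msc_left_unitalP; rewrite /= !mx24E; field;
     rewrite ?two_neq0 ?a1_neq0.
Qed.

(** * Independent traces: the two trace forms as coordinates *)

Definition canonical_traces A :=
  (forall x, rtrace A x = x 0 0) /\ (forall x, ltrace A x = x 1 0).

(** An isomorphism preserves both traces, which here are the coordinates, so it is the identity. *)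
Lemma canonical_traces_iso A B :
  canonical_traces A -> canonical_traces B ->
  alg_iso (msc_alg A) (msc_alg B) -> A = B.
Proof.
move=> [rA lA] [rB lB] /trace_iso[g _ [gM lg rg]].
have gE x : g *m x = x by apply: cV2P; rewrite -?rB -?lB ?rg ?lg ?rA ?lA.
by apply: msc_alg_inj => x y; rewrite -[LHS]gE gM !gE.
Qed.

Lemma canonical_traces_A1 a b : b != 0 -> canonical_traces (lu_msc (LU_A1 a b)).
Proof.
by move=> b_neq0; split=> x;
   rewrite /rtrace /ltrace /= !mx24E; field;
     rewrite ?two_neq0 ?b1_neq0 ?b_neq0.
Qed.

Lemma canonical_traces_A1' a : canonical_traces (lu_msc (LU_A1' a)).
Proof. by split=> x; rewrite /rtrace /ltrace /= !mx24E; ring. Qed.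

(** The trace conditions express [A 0 2], [A 1 1], [A 1 2] and [A 1 3] through the other entries;
    the left unit equations then leave only the parameters of A1 or A1'. *)
Lemma left_unital_canonical A :
  canonical_traces A -> left_unital (msc_alg A) ->
  exists2 p, lu_admissible p & A = lu_msc p.
Proof.
move=> [rA lA] [u uP].
have := (rA (vec2 1 0), rA (vec2 0 1), lA (vec2 1 0), lA (vec2 0 1)).
rewrite /rtrace /ltrace !vec2E !mulr0 !mulr1 !(addr0, add0r).
move=> [[[r0 r1] l0] l1].
have uE v i := congr1 (fun x : 'cV_2 => x i 0) (uP v).
have := (uE (vec2 1 0) 0, uE (vec2 1 0) 1, uE (vec2 0 1) 0, uE (vec2 0 1) 1).
rewrite !msc_algE !vec2E !mulr0 !mulr1 !(addr0, add0r).
move: (u 0 0) (u 1 0) => z w [[[u00 u10] u01] u11].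
(* Left multiplication by the unit has trace [2], and the left trace is the second coordinate. *)
have w2 : w = 2.
  transitivity ((A 0 0 + A 1 1) * z + (A 0 2 + A 1 3) * w).
    by rewrite l0 l1; ring.
  by transitivity ((A 0 0 * z + A 0 2 * w) + (A 1 1 * z + A 1 3 * w));
     [ring | rewrite u00 u11; ring].
have A11 : A 1 1 = - A 0 0 by apply/eqP; rewrite -addr_eq0 addrC l0.
have A12 : A 1 2 = 1 - A 0 0 by rewrite -r0; ring.
have A13 : A 1 3 = - A 0 1 by apply/eqP; rewrite -addr_eq0 addrC r1.
have A02 : A 0 2 = 1 + A 0 1 by rewrite -l1 A13; ring.
have A03 : A 0 3 = - (A 0 1 * z) / 2.
  by rewrite -[LHS](mulfK two_neq0) -w2
     -[A 0 3 * w](addKr (A 0 1 * z)) u01 addr0.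
rewrite w2 A02 A12 in u00 u10.
(* By [u10], [A 1 0 * z + (1 - A 0 0) * 2 = 0]: a zero [A 1 0] forces [A 0 0 = 1], a nonzero one
   determines [z]. *)
have [b0 | b_neq0] := eqVneq (A 1 0) 0.
  have a1 : A 0 0 = 1.
    apply/esym/eqP; rewrite -subr_eq0 -(mulIr_eq0 _ (mulIf two_neq0)).
    by rewrite -u10 b0 mul0r add0r.
  have z1 : z = - 1 - 2 * A 0 1.
    have -> : z = A 0 0 * z + (1 + A 0 1) * 2 - (1 + A 0 1) * 2.
      by rewrite a1; ring.
    by rewrite u00; ring.
  exists (LU_A1' (A 0 1)) => //; rewrite [LHS]mx24_eta /=.
  rewrite A11 A12 A13 A02 A03 a1 b0 z1.
  by congr (mx24 [:: _; _; _; _] [:: _; _; _; _]); field.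
have zE : z = - 2 * (1 - A 0 0) / A 1 0.
  rewrite -[LHS](mulKf b_neq0) -[A 1 0 * z](addrK ((1 - A 0 0) * 2)) u10.
  by field.
have A01 : A 0 1 = (1 - A 0 0 * z) / 2 - 1.
  by rewrite -{1}u00; field.
exists (LU_A1 (A 0 0) (A 1 0)) => //; rewrite [LHS]mx24_eta /=.
rewrite A11 A12 A13 A02 A03 A01 zE.
by congr (mx24 [:: _; _; _; _] [:: _; _; _; _]); field;
   rewrite ?two_neq0 ?b_neq0.
Qed.

(** The nonzero quantity is the determinant of the two trace forms, so the pair of traces is an
    invertible change of coordinates. *)
Lemma left_unital_independent A :
  (A 0 0 + A 1 2) * (A 0 2 + A 1 3) - (A 0 1 + A 1 3) * (A 0 0 + A 1 1) != 0 ->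
  left_unital (msc_alg A) ->
  exists2 p, lu_admissible p & alg_iso (msc_alg A) (msc_alg (lu_msc p)).
Proof.
move=> /mx22_unit; set g := mx22 _ _ _ _ => g_unit A_unital.
have gE x : g *m x = vec2 (rtrace A x) (ltrace A x) by exact: mx22_mul.
pose B := g *m A *m (invmx g *t invmx g) : 'M[F]_(2, 4).
have isoAB : alg_iso (msc_alg A) (msc_alg B) by apply/msc_isoP; exists g.
have [lg rg] := trace_mulmx g_unit (msc_conjM g_unit (erefl B)).
have B_canonical : canonical_traces B.
  by split=> y; rewrite -[y](mulKVmx g_unit) ?rg ?lg gE vec2E.
have [p p_adm defB] :=
  left_unital_canonical B_canonical (left_unital_iso isoAB A_unital).
by exists p; rewrite -?defB.
Qed.

(** * Dependent traces: invariants of the last four families *)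

(* The common shape of the last four families; [r] tells [A2], [A4] from [A6],
   [A8], and [d] tells [A2], [A6] from [A4], [A8]. *)
Definition diag_msc (a r d : F) := mx24 [:: a; 0; 0; d] [:: 0; a; - a + r; 0].

(** [None] marks the two families with canonical traces; otherwise the triple holds the arguments of
    [diag_msc]. *)
Definition diag_shape (p : lu_param F) : option (F * F * F) :=
  match p with
  | LU_A1 _ _ | LU_A1' _ => None
  | LU_A2 a => Some (a, 1, 1)
  | LU_A4 a => Some (a, 1, 0)
  | LU_A6 => Some (2^-1, 0, 1)
  | LU_A8 => Some (2^-1, 0, 0)
  end.

Lemma diag_shapeP (p : lu_param F) : lu_admissible p ->
  if diag_shape p is Some (a, r, d)
  then a != 0 /\ lu_msc p = diag_msc a r d
  else canonical_traces (lu_msc p).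
Proof.
case: p => [a1 b1|a2|a1|a1||] /= p_adm.
- exact: canonical_traces_A1.
- exact: canonical_traces_A1'.
- by split.
- by split.
- by rewrite /diag_msc addr0 invr_eq0.
- by rewrite /diag_msc addr0 invr_eq0.
Qed.

Lemma diag_ltrace a r d x : ltrace (diag_msc a r d) x = 2 * a * x 0 0.
Proof. by rewrite /ltrace !mx24E; ring. Qed.

Lemma diag_rtrace a r d x : rtrace (diag_msc a r d) x = r * x 0 0.
Proof. by rewrite /rtrace !mx24E; ring. Qed.

(** Both traces of [diag_msc] vanish on the second basis vector, whereas canonical traces have no
    common nonzero zero. *)
Lemma canonical_diag A a r d :
  canonical_traces A -> ~ alg_iso (msc_alg A) (msc_alg (diag_msc a r d)).
Proof.
move=> [rA lA] /trace_iso[g g_unit [_ lg rg]].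
pose x := invmx g *m vec2 0 1.
have gx : g *m x = vec2 0 1 by rewrite mulKVmx.
have x0 : x = 0.
  apply: cV2P; rewrite [RHS]mxE -?rA -?lA -?rg -?lg gx.
    by rewrite diag_rtrace vec2E mulr0.
  by rewrite diag_ltrace vec2E mulr0.
have := vec2_1 (0 : F) 1; rewrite -gx x0 mulmx0 mxE => /esym/eqP.
by rewrite oner_eq0.
Qed.

(** Two invariants are compared: the ratio [r / (2 * a)] of the right trace to the left one, and
    whether the kernel of the left trace, the line of the second basis vector, squares to zero. *)
Lemma diag_iso a r d a' r' d' : a != 0 -> a' != 0 ->
  alg_iso (msc_alg (diag_msc a r d)) (msc_alg (diag_msc a' r' d')) ->
  r * a' = r' * a /\ (d' = 0 -> d = 0).
Proof.
move=> a_neq0 a'_neq0 /trace_iso[g g_unit [gM lg rg]].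
have g0 x : (g *m x) 0 0 = a / a' * x 0 0.
  have := lg x; rewrite !diag_ltrace -!mulrA => /(mulfI two_neq0) E.
  by rewrite mulrCA -E mulKf.
split=> [|d'0].
  have := rg (vec2 1 0); rewrite !diag_rtrace g0 vec2E !mulr1 => <-.
  by field.
have := congr1 (fun u : 'cV_2 => u 0 0) (gM (vec2 0 1) (vec2 0 1)).
rewrite g0 !msc_algE !g0 !vec2E !mx24E d'0.
rewrite !(mulr0, mul0r, addr0, add0r, mulr1) => /eqP.
by rewrite !mulf_eq0 invr_eq0 (negPf a_neq0) (negPf a'_neq0) => /eqP.
Qed.

Lemma lu_msc_canonical_inj (p q : lu_param F) :
  lu_admissible p -> lu_admissible q -> diag_shape p = None ->
  diag_shape q = None -> lu_msc p = lu_msc q -> p = q.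
Proof.
case: p => // [a b|a]; case: q => // [a' b'|a'] /= b_neq0 b'_neq0 _ _ eqA;
  have /= := (congr1 (fun A => A 0 0) eqA, congr1 (fun A => A 0 1) eqA,
              congr1 (fun A => A 1 0) eqA); rewrite !mx24E => -[[e00 e01] e10].
- by rewrite e00 e10.
- by rewrite e10 eqxx in b_neq0.
- by rewrite -e10 eqxx in b'_neq0.
- by rewrite e01.
Qed.

Lemma lu_msc_iso_inj (p q : lu_param F) : lu_admissible p -> lu_admissible q ->
  alg_iso (msc_alg (lu_msc p)) (msc_alg (lu_msc q)) -> p = q.
Proof.
move=> p_adm q_adm iso_pq.
have := (diag_shapeP p_adm, diag_shapeP q_adm).
case Dp: (diag_shape p) => [[[a r] d]|];
  case Dq: (diag_shape q) => [[[a' r'] d']|].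
- move=> [[a_neq0 Ep] [a'_neq0 Eq]]; rewrite Ep Eq in iso_pq.
  have [ra dd'] := diag_iso a_neq0 a'_neq0 iso_pq.
  have [_ d'd] := diag_iso a'_neq0 a_neq0 (alg_iso_sym iso_pq).
  have ne10 : 1 = 0 :> F -> False by move/eqP; rewrite oner_eq0.
  (* Distinct values of [d] give [1 = 0]; distinct values of [r] make [a] or [a'] zero; if both
     agree, [ra] identifies the parameters. *)
  case: p Dp {p_adm Ep} => [? ?|?|?|?||] //= [? ? ?];
    case: q Dq {q_adm Eq} => [? ?|?|?|?||] //= [? ? ?]; subst=> //;
    move: ra; rewrite ?mul1r ?mul0r => ra; rewrite ?ra //;
    try (by case: ne10; auto); by move: a_neq0 a'_neq0; rewrite ra eqxx.
- move=> [[_ Ep] q_can].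
  case: (canonical_diag q_can (a := a) (r := r) (d := d)).
  by rewrite -Ep; apply: alg_iso_sym.
- move=> [p_can [_ Eq]]; rewrite Eq in iso_pq.
  by case: (canonical_diag p_can iso_pq).
- move=> [p_can q_can]; apply: lu_msc_canonical_inj => //.
  exact: canonical_traces_iso.
Qed.

(** * Normal form around a left unit, and its reduction when the traces are dependent *)

Definition unital_msc (x c p q : F) := mx24 [:: 1; 0; x; p] [:: 0; 1; c; q].

(** The first algebra is the second one rewritten in the basis [(e, f + t e)]. *)
Lemma unital_msc_shift (x c p q t : F) :
  alg_iso (msc_alg (unital_msc (x + t * (1 - c)) c
                      (p + t * x - t * q - t ^+ 2 * c) (q + t * (1 + c))))
          (msc_alg (unital_msc x c p q)).
Proof.
apply: (@mx22_iso _ _ _ 1 t 0 1); first by rewrite mulr0 subr0 mulr1 oner_eq0.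
move=> u v; apply: cV2P;
  by rewrite [RHS]msc_algE !mx22_mul !vec2E !msc_algE !mx24E; ring.
Qed.

(** In the basis [(a e, s f)], left multiplication by [a e] is the scalar [a], the product of [s f]
    and [a e] is [a * c] times [s f], and [s f] squares to [s ^+ 2 * p / a] times [a e]. *)
Lemma unital_msc_scale c p a r d s : a != 0 -> s != 0 ->
  a * c = - a + r -> s ^+ 2 * p = a * d ->
  alg_iso (msc_alg (diag_msc a r d)) (msc_alg (unital_msc 0 c p 0)).
Proof.
move=> a_neq0 s_neq0 Er Ed.
apply: (@mx22_iso _ _ _ a 0 0 s); first by rewrite mulr0 subr0 mulf_neq0.
have -> : r = a * c + a by rewrite Er; ring.
have -> : d = s ^+ 2 * p / a by rewrite Ed mulrAC mulfV // mul1r.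
move=> u v; apply: cV2P;
  by rewrite [RHS]msc_algE !mx22_mul !vec2E !msc_algE !mx24E; field.
Qed.

End Classification.

Lemma closed_field_sqrt (F : closedFieldType) (a : F) :
  exists s, s ^+ 2 = a.
Proof.
(* The default [0] of [nth] supplies the coefficient of degree one. *)
have [s Es] := @solve_monicpoly F 2 (nth 0 [:: a]) isT.
by exists s; rewrite Es !big_ord_recl big_ord0 /= expr0 mulr1 mul0r !addr0.
Qed.

(** On [(e, f)] the left trace is [2], [x + q] and the right trace is [1 + c], [q], so the second
    hypothesis is the vanishing of their determinant. *)
Lemma unital_msc_dependent (F : closedFieldType) (x c p q : F) :
  2 != 0 :> F -> 2 * q = (1 + c) * (x + q) ->
  exists2 P, lu_admissible P &
    alg_iso (msc_alg (unital_msc x c p q)) (msc_alg (lu_msc P)).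
Proof.
move=> two_neq0 dep.
have [t [xt qt]] : exists t, x + t * (1 - c) = 0 /\ q + t * (1 + c) = 0.
  (* For [c = 1] dependence forces [x = 0] and [t] only has to kill [q]; otherwise [t] is chosen to
     kill [x], and dependence makes [q] vanish too. *)
  have [c1|c_neq1] := eqVneq c 1.
    exists (- q / 2); rewrite c1; split; last by field.
    apply: (mulfI two_neq0); rewrite mulr0 subrr mulr0 addr0.
    have -> : 2 * x = (1 + c) * (x + q) - 2 * q by rewrite c1; ring.
    by rewrite dep subrr.
  have c_neq : c - 1 != 0 by rewrite subr_eq0.
  exists (x / (c - 1)); split; first by field.
  apply: (mulfI c_neq).
  have -> : (c - 1) * (q + x / (c - 1) * (1 + c)) = (1 + c) * (x + q) - 2 * q.
    by field.
  by rewrite dep subrr mulr0.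
have := unital_msc_shift x c p q t; rewrite xt qt.
move: (p + _ - _ - _) => p' /alg_iso_sym iso_shift.
(* The constraint is [a * (1 + c) = r]: [r = 1] fixes [a] unless [c = -1], where [r = 0] and [a] is
   free; [2^-1] is the value in A6 and A8. *)
pose a := if c == -1 then 2^-1 else (1 + c)^-1.
pose r : F := if c == -1 then 0 else 1.
have a_neq0 : a != 0.
  by rewrite /a; case: (eqVneq c (-1)) => c1;
     rewrite invr_eq0 // addrC addr_eq0.
have Er : a * c = - a + r.
  rewrite /a /r; have [->|c_neq] := eqVneq c (-1).
    by rewrite mulrN1 addr0.
  by field; rewrite addrC addr_eq0.
pose d : F := if p' == 0 then 0 else 1.
have [s s_neq0 Ed] : exists2 s, s != 0 & s ^+ 2 * p' = a * d.
  rewrite /d; have [->|p'_neq0] := eqVneq p' 0.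
    by exists 1; rewrite ?oner_eq0 ?mulr0.
  (* Normalising a nonzero [p'] to [d = 1] takes a square root, available over an algebraically
     closed field. *)
  have [s Es] := closed_field_sqrt (a / p').
  exists s; last by rewrite Es mulfVK // mulr1.
  apply: contraNneq a_neq0 => s0; move: Es.
  rewrite s0 expr0n /= => /esym/eqP.
  by rewrite mulf_eq0 invr_eq0 (negPf p'_neq0) orbF.
have iso_scale := unital_msc_scale a_neq0 s_neq0 Er Ed.
have := alg_iso_trans iso_shift (alg_iso_sym iso_scale).
rewrite /a /r /d; have [_|c_neq] := eqVneq c (-1); have [_|_] := eqVneq p' 0.
- by rewrite /diag_msc addr0; exists LU_A8.
- by rewrite /diag_msc addr0; exists LU_A6.
- by exists (LU_A4 (1 + c)^-1) => //=; rewrite invr_eq0 addrC addr_eq0.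
- by exists (LU_A2 (1 + c)^-1) => //=; rewrite invr_eq0 addrC addr_eq0.
Qed.

(** * From abstract algebras to structure constants *)

Lemma msc_iso_basis (F : fieldType) (V : vectType F)
    (mu : {bilinear V -> V -> V}) (b : 2.-tuple V) (A : 'M[F]_(2, 4)) :
  basis_of {:V} b ->
  mu b`_0 b`_0 = A 0 0 *: b`_0 + A 1 0 *: b`_1 ->
  mu b`_0 b`_1 = A 0 1 *: b`_0 + A 1 1 *: b`_1 ->
  mu b`_1 b`_0 = A 0 2 *: b`_0 + A 1 2 *: b`_1 ->
  mu b`_1 b`_1 = A 0 3 *: b`_0 + A 1 3 *: b`_1 ->
  alg_iso mu (msc_alg A).
Proof.
move=> b_basis m00 m01 m10 m11; apply: alg_iso_sym.
pose f (v : 'cV[F]_2) := \sum_(i < 2) v i 0 *: b`_i.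
have f_linear : linear f.
  move=> k u v; rewrite /f scaler_sumr -big_split /=.
  by apply: eq_bigr => i _; rewrite !mxE scalerDl scalerA.
pose fM := GRing.isLinear.Build F 'cV[F]_2 V _ f f_linear.
pose fL : {linear 'cV[F]_2 -> V} := HB.pack f fM.
have fE v : f v = v 0 0 *: b`_0 + v 1 0 *: b`_1.
  by rewrite /f big_ord_recl big_ord1; congr (_ + v _ _ *: _); apply: val_inj.
exists fL; split.
  exists (fun x => \col_i coord b i x) => [v|x].
    apply/colP=> i; rewrite mxE.
    exact: (coord_sum_free (fun j => v j 0) i (basis_free b_basis)).
  rewrite /= /f [RHS](coord_basis b_basis (memvf x)).
  by apply: eq_bigr => i _; rewrite mxE.
have defc (u : 'cV[F]_2) : u = u 0 0 *: vec2 1 0 + u 1 0 *: vec2 0 1.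
  by apply: cV2P; rewrite !mxE /= !(mulr0, mulr1, addr0, add0r).
have f0 : f (vec2 1 0) = b`_0 by rewrite fE !vec2E scale1r scale0r addr0.
have f1 : f (vec2 0 1) = b`_1 by rewrite fE !vec2E scale1r scale0r add0r.
have fD x y : f (x + y) = f x + f y by exact: (linearD fL).
have fZ k x : f (k *: x) = k *: f x by exact: (linearZ_LR fL).
move=> u v /=; rewrite [u]defc [v]defc.
rewrite !(linearDl, linearDr, linearZl_LR, linearZr_LR) /=.
rewrite !(fD, fZ) !(linearDl, linearDr, linearZl_LR, linearZr_LR) /= f0 f1.
rewrite m00 m01 m10 m11 !fE !msc_algE !vec2E.
by rewrite !(mulr0, mul0r, mulr1, addr0, add0r).
Qed.

Lemma left_unital_normal_form (F : fieldType) (V : vectType F)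
    (mu : {bilinear V -> V -> V}) :
  \dim {:V} = 2%N -> left_unital mu ->
  exists x c p q : F, alg_iso mu (msc_alg (unital_msc x c p q)).
Proof.
move=> dimV [e eP].
have [f _ fNe] : exists2 f, f \in fullv & f \notin <[e]>%VS.
  apply/subvPn; apply: contraL (isT : 1 < 2)%N => /dimvS.
  by rewrite dimV dim_vline -leqNgt => /leq_trans; apply; case: eqP.
(* If [e] were zero, [f], being the product of [e] and [f], would vanish and lie on the line of
   [e]. *)
have e_neq0 : e != 0.
  by apply: contraNneq fNe => e0; rewrite -(eP f) e0 linear0l mem0v.
pose b := [tuple e; f].
have b_basis : basis_of {:V} b.
  rewrite basisEfree subvf dimV /= andbT.
  (* [free_cons] tests the head against the span of the tail, and the known fact is that [f] is off
     the line of [e]. *)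
  have -> : free [:: e; f] = free [:: f; e].
    by apply: perm_free; rewrite (perm_catC [:: e] [:: f]).
  by rewrite free_cons span_seq1 fNe seq1_free.
have coordE y : exists k l, y = k *: e + l *: f.
  exists (coord b 0 y), (coord b 1 y).
  rewrite {1}(coord_basis b_basis (memvf y)) big_ord_recl big_ord1.
  by congr (_ + coord _ _ _ *: _); apply: val_inj.
have [x [c fe]] := coordE (mu f e); have [p [q ff]] := coordE (mu f f).
exists x, c, p, q; apply: (msc_iso_basis b_basis); rewrite !mx24E ?eP //.
  by rewrite scale1r scale0r addr0.
by rewrite scale1r scale0r add0r.
Qed.

(** * Assembling the classification *)

Lemma left_unital_classification (F : closedFieldType) (V : vectType F)
    (mu : {bilinear V -> V -> V}) :
  2 != 0 :> F -> \dim {:V} = 2%N -> left_unital mu ->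
  exists2 P, lu_admissible P & alg_iso mu (msc_alg (lu_msc P)).
Proof.
move=> two_neq0 dimV mu_unital.
have [x [c [p [q isoN]]]] := left_unital_normal_form dimV mu_unital.
have N_unital := left_unital_iso isoN mu_unital.
suff [P P_adm isoP] : exists2 P, lu_admissible P &
    alg_iso (msc_alg (unital_msc x c p q)) (msc_alg (lu_msc P)).
  by exists P => //; apply: alg_iso_trans isoN isoP.
have [dep|indep] := eqVneq (2 * q) ((1 + c) * (x + q)).
  exact: unital_msc_dependent.
(* For the normal form the determinant of the traces is the opposite of
   [2 * q - (1 + c) * (x + q)]. *)
apply: left_unital_independent => //; rewrite !mx24E -subr_eq0 in indep *.
apply: contraNneq indep => E; rewrite -oppr_eq0 -E.
by apply/eqP; ring.
Qed.

Theorem theorem3p3 (F : closedFieldType) (charF3 : 3%N \in [pchar F]) :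
  (forall p : lu_param F, lu_admissible p ->
     nontrivial_alg (msc_alg (lu_msc p)) /\ left_unital (msc_alg (lu_msc p)))
  /\ (forall p q : lu_param F, lu_admissible p -> lu_admissible q ->
        alg_iso (msc_alg (lu_msc p)) (msc_alg (lu_msc q)) -> p = q)
  /\ (forall (V : vectType F) (mu : {bilinear V -> V -> V}),
        \dim {:V} = 2%N -> nontrivial_alg mu -> left_unital mu ->
        exists! p : lu_param F,
          lu_admissible p /\ alg_iso mu (msc_alg (lu_msc p))).
Proof.
have two_neq0 : 2 != 0 :> F by rewrite -(dvdn_pcharf charF3).
split=> [p p_adm|].
  have p_unital := lu_msc_left_unital two_neq0 p_adm; split=> //.
  apply: (left_unital_nontrivial (u := vec2 1 0)) p_unital.
  by apply/eqP=> /(congr1 (fun u : 'cV_2 => u 0 0))/eqP; rewrite !mxE oner_eq0.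
split=> [p q|V mu dimV _ mu_unital]; first exact: lu_msc_iso_inj.
have [p p_adm iso_p] := left_unital_classification two_neq0 dimV mu_unital.
exists p; split=> // q [q_adm iso_q]; apply: lu_msc_iso_inj => //.
exact: alg_iso_trans (alg_iso_sym iso_p) iso_q.
Qed.
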